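(* Let $S$ be an inverse semigroup that is neither a one-element group nor a two-element semilattice. Then the following properties are equivalent: (1) $S$ is noble, that is, $S$ is isomorphic to a transitive inverse semigroup of one-to-one partial transformations of some set $A$; (2) $S$ possesses an infinitesimal basis; (3) $S$ possesses an infinitesimal closed inverse subsemigroup.
   Context: An inverse semigroup is a nonempty semigroup $S$ in which every $s$ has a unique inverse $s^{-1}$ (with $ss^{-1}s=s$ and $s^{-1}ss^{-1}=s^{-1}$). An inverse subsemigroup is a nonempty subset closed under multiplication and inversion. A semilattice is an inverse semigroup in which every element is idempotent. For a set $A$, $\mathcal{I}_A$ is the inverse semigroup of all one-to-one partial transformations of $A$ (injective maps from a subset of $A$ into $A$, including the empty one) under composition of partial maps, written on the right: $a(\varphi\psi)=(a\varphi)\psi$ whenever both $a\varphi$ and $(a\varphi)\psi$ are defined. An inverse semigroup of one-to-one partial transformations of $A$ is an inverse subsemigroup $\Phi$ of $\mathcal{I}_A$; it is transitive if for all $a,b\in A$ there is $\varphi\in\Phi$ with $a\varphi=b$. The natural order on $S$ is $s\le t \Leftrightarrow s=ss^{-1}t$. A subset $H\subseteq S$ is closed if $s\in H$ and $s\le t$ imply $t\in H$. For $s\in S$ put $\vec{s}=\{t\in S: s\le t\}$. The triple product is $[stu]=st^{-1}u$. A filter of $S$ is a nonempty proper subset $F\subset S$ that is closed and closed under the triple product ($s,t,u\in F\Rightarrow st^{-1}u\in F$). Filters $F_1,F_2$ of $S$ are of the same magnitude with respect to $S$, written $F_1\sim F_2$, if there exist $u,v\in S$ such that $uF_1v^{-1}\subseteq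 F_2$ and $u^{-1}F_2v\subseteq F_1$ (products of elements and subsets are taken elementwise). An infinitesimal basis of $S$ is an indexed set $\{F_i: i\in I\}$ of filters of $S$, all of the same magnitude, such that for every $s\in S$, $\vec{s}=\bigcap\{F_i: i\in I,\ s\in F_i\}$. The intersection of an empty family of subsets of $S$ is understood to be $S$ (so if $S$ has a zero $0$, then $0$ corresponds to the empty set of filters). Inverse subsemigroups $H$ and $K$ of $S$ are conjugate if $H$ and $K$ are filters of $S$ and $H\sim K$. For a closed inverse subsemigroup $H$ of $S$, let $\mathcal{E}_H$ be the set of all closed inverse subsemigroups of $S$ conjugate to $H$. $H$ is called infinitesimal if every idempotent $e\in S$ is the least upper bound of an appropriate subset of $\mathcal{E}_H$, meaning that for every idempotent $e\in S$, $\vec{e}=\bigcap\{F: e\in F\in\mathcal{E}_H\}$, where $\vec{e}$ is taken in $S$ (it may contain non-idempotents) and the empty intersection is again $S$. *)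

(* Defs.v *)
From HB Require Import structures.
From mathcomp Require Import all_boot.
From mathcomp Require Import boolp classical_sets functions cardinality.

Set Implicit Arguments.
Unset Strict Implicit.
Unset Printing Implicit Defensive.

Local Open Scope classical_set_scope.
Local Open Scope group_scope.

Definition mutually_inverse (S : semigroupType) (s t : S) : Prop :=
  s * t * s = s /\ t * s * t = t.

(* The axiom invsP says that s has exactly one inverse, namely [invs s].
   The [choiceType] structure underlying [semigroupType] is no restriction
   classically: any type carries one, see [gen_eqMixin] and [gen_choiceMixin]
   in boolp. *)
HB.mixin Record Semigroup_isInverseSemigroup S of Semigroup S := {
  invs : S -> S;
  invsP : forall s t : S, mutually_inverse s t <-> t = invs s;
  inhabitedS : inhabited S
}.

#[short(type="inverseSemigroupType")]
HB.structure Definition InverseSemigroup :=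
  { S of Semigroup_isInverseSemigroup S & Semigroup S }.

(* MathComp's own [^-1] of group_scope is restricted to types with a unit. *)
Local Notation "s ^-1" := (invs s) : group_scope.

Section InverseSemigroups.
Variable S : inverseSemigroupType.
Implicit Types (s t u : S) (F H K : set S).

Definition is_group : Prop :=
  exists e : S, (forall s, e * s = s /\ s * e = s) /\
                (forall s, exists t, s * t = e /\ t * s = e).

Definition one_element_group : Prop := is_group /\ ([set: S] #= `I_1)%card.

Definition is_semilattice : Prop := forall s, s * s = s.

Definition two_element_semilattice : Prop :=
  is_semilattice /\ ([set: S] #= `I_2)%card.

Definition inverse_subsemigroup H : Prop :=
  [/\ H !=set0,
      forall s t, H s -> H t -> H (s * t)
    & forall s, H s -> H s^-1].

Definition natural_le s t : Prop := s = s * s^-1 * t.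

Definition up_closed H : Prop := forall s t, H s -> natural_le s t -> H t.

Definition up s : set S := [set t | natural_le s t].

Definition triple s t u : S := s * t^-1 * u.

Definition is_filter F : Prop :=
  [/\ F !=set0, F <> [set: S], up_closed F
    & forall s t u, F s -> F t -> F u -> F (triple s t u)].

Definition same_magnitude F1 F2 : Prop :=
  exists u v : S, [set u * f * v^-1 | f in F1] `<=` F2 /\
                  [set u^-1 * f * v | f in F2] `<=` F1.

(* In classical_sets the intersection of an empty family is the full set. *)
Definition infinitesimal_basis (I : Type) (F : I -> set S) : Prop :=
  [/\ forall i, is_filter (F i),
      forall i j, same_magnitude (F i) (F j)
    & forall s, up s = \bigcap_(i in [set i | F i s]) F i].

Definition closed_inverse_subsemigroup H : Prop :=
  inverse_subsemigroup H /\ up_closed H.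

Definition conjugate H K : Prop :=
  [/\ inverse_subsemigroup H, inverse_subsemigroup K,
      is_filter H, is_filter K & same_magnitude H K].

Definition conjugates H : set (set S) :=
  [set K | closed_inverse_subsemigroup K /\ conjugate H K].

Definition infinitesimal H : Prop :=
  forall e, e * e = e ->
    up e = \bigcap_(F in [set F | conjugates H F /\ F e]) F.

End InverseSemigroups.

(* One-to-one partial transformations of A: [f a = None] means that f is
   undefined at a. *)
Record partial_inj (A : Type) := PartialInj {
  pinj_fun :> A -> option A;
  pinj_inj : forall a b c,
    pinj_fun a = Some c -> pinj_fun b = Some c -> a = b
}.

HB.instance Definition _ (A : Type) := gen_eqMixin (partial_inj A).
HB.instance Definition _ (A : Type) := gen_choiceMixin (partial_inj A).

Section SymmetricInverseSemigroup.
Variable A : Type.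
Implicit Types f g h : partial_inj A.

Lemma pinjP f g : (forall a b, f a = Some b <-> g a = Some b) -> f = g.
Proof.
move=> fg; case: f fg => f fi; case: g => g gi /= fg.
have e : f = g.
  apply/funext => a; case E: (f a) => [b|].
    by move/fg: E.
  by case E': (g a) => [b|//]; move/fg: E'; rewrite E.
by subst g; congr PartialInj; exact: Prop_irrelevance.
Qed.

(* Maps act on the right: f is applied first. *)
Definition pinj_comp_fun f g : A -> option A := pcomp g f.

Lemma pinj_compE f g a c :
  pinj_comp_fun f g a = Some c <-> exists2 b, f a = Some b & g b = Some c.
Proof.
rewrite /pinj_comp_fun /pcomp; case E: (f a) => [b|] /=.
  by split=> [?|[b' [<-]]//]; exists b.
by split=> // -[].
Qed.

Lemma pinj_comp_inj f g a b c :
  pinj_comp_fun f g a = Some c -> pinj_comp_fun f g b = Some c -> a = b.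
Proof.
move=> /pinj_compE[x fa gx] /pinj_compE[y fb gy].
move: fb; rewrite -(pinj_inj gx gy); exact: pinj_inj fa.
Qed.

Definition pinj_comp f g : partial_inj A := PartialInj (@pinj_comp_inj f g).

Lemma pinj_compA : associative pinj_comp.
Proof.
move=> f g h; apply: pinjP => a d; split.
  move=> /pinj_compE[b fa /pinj_compE[c gb hc]].
  by apply/pinj_compE; exists c => //; apply/pinj_compE; exists b.
move=> /pinj_compE[c /pinj_compE[b fa gb] hc].
by apply/pinj_compE; exists b => //; apply/pinj_compE; exists c.
Qed.

HB.instance Definition _ := isSemigroup.Build (partial_inj A) pinj_compA.

Definition pinj_inv_fun f (b : A) : option A :=
  if pselect (exists a, f a = Some b) is left fb then Some (projT1 (cid fb))
  else None.

Lemma pinj_invE f a b : pinj_inv_fun f b = Some a <-> f a = Some b.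
Proof.
rewrite /pinj_inv_fun; case: pselect => [fb|nfb].
  case: cid => a' /= fa'; split=> [[<-]//|fa].
  by rewrite (pinj_inj fa fa').
by split=> // fa; case: nfb; exists a.
Qed.

Lemma pinj_inv_inj f a b c :
  pinj_inv_fun f a = Some c -> pinj_inv_fun f b = Some c -> a = b.
Proof. by move=> /pinj_invE fa /pinj_invE; rewrite fa => -[]. Qed.

Definition pinj_inv f : partial_inj A := PartialInj (@pinj_inv_inj f).

Lemma pinj_invP f g : mutually_inverse f g <-> g = pinj_inv f.
Proof.
split=> [[fgf gfg]|->].
- apply: pinjP => b a; split.
    move=> gb; move: (gb); rewrite -{1}gfg.
    move=> /pinj_compE[b' /pinj_compE[a' gb' fa' gb'']].
    apply/pinj_invE; move: gb' fa'; rewrite gb => -[<-] fa'.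
    by rewrite fa' (pinj_inj gb gb'').
  move=> /pinj_invE fa; move: (fa); rewrite -{1}fgf.
  move=> /pinj_compE[a' /pinj_compE[b' fa' gb'] fa''].
  by move: fa'; rewrite fa => -[->]; rewrite gb' (pinj_inj fa fa'').
- split; apply: pinjP => a b; split.
  + move=> /pinj_compE[c /pinj_compE[d fa /pinj_invE fc] fb].
    by rewrite (pinj_inj fa fc).
  + move=> fa; apply/pinj_compE; exists a => //.
    by apply/pinj_compE; exists b => //; apply/pinj_invE.
  + move=> /pinj_compE[c /pinj_compE[d /pinj_invE fd fdc] /pinj_invE fb].
    by apply/pinj_invE; rewrite fb -fd fdc.
  + move=> /pinj_invE fb; apply/pinj_compE; exists a; last exact/pinj_invE.
    by apply/pinj_compE; exists b => //; apply/pinj_invE.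
Qed.

Lemma pinj_id_inj (a b c : A) : Some a = Some c -> Some b = Some c -> a = b.
Proof. by move=> [->] [->]. Qed.

Lemma pinj_inhabited : inhabited (partial_inj A).
Proof. exact: (inhabits (PartialInj pinj_id_inj)). Qed.

HB.instance Definition _ :=
  Semigroup_isInverseSemigroup.Build (partial_inj A) pinj_invP pinj_inhabited.

Definition transitive_set (Phi : set (partial_inj A)) : Prop :=
  forall a b : A, exists2 f, Phi f & f a = Some b.

End SymmetricInverseSemigroup.

Definition noble (S : inverseSemigroupType) : Prop :=
  exists (A : Type) (Phi : set (partial_inj A)),
    [/\ inverse_subsemigroup Phi, transitive_set Phi
      & exists2 h : S -> partial_inj A, set_bij [set: S] Phi h
                                     & {morph h : s t / s * t}].

(* Main.v *)
Require Import Defs.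
From mathcomp Require Import all_boot.
From mathcomp Require Import boolp classical_sets functions cardinality.

(** The three properties are proved equivalent in the cycle
    noble, infinitesimal basis, infinitesimal subsemigroup, noble.

    If [S] acts faithfully and transitively on [A], the sets
    [F a b = {s | s maps a to b}] form an infinitesimal basis
    ([noble_infinitesimal_basis]): they are filters, they are of the same
    magnitude because elements [u : c -> a] and [v : d -> b] carry [F a b] to
    [F c d], and [s <= t] says that the graph of [s] lies in that of [t], that
    is, that [t] belongs to every [F a b] containing [s].

    A filter [F] behaves as a coset: its left stabilizer
    [H = {h | h F is included in F}] is a closed inverse subsemigroup, of the
    same magnitude as [F] ([same_magnitude_stab]).  A member [F i] of a basis
    that contains an idempotent is itself an inverse subsemigroup, hence a
    conjugate of the stabilizer [H] of any fixed member.  So the equality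
    [up e = \bigcap F i] of the basis makes [H] infinitesimal
    ([basis_infinitesimal]).

    Conversely, let a closed inverse subsemigroup [H] be given.  Then [S] acts
    transitively on the right cosets of [H] by right multiplication.  Every
    conjugate of [H] turns out to have the form
    [K = {k | u^-1 k u in H}] ([conjugate_conj]), so that it stabilizes a point
    in this action.  If [s] and [t] act in the same way,
    then [t s^-1] lies in every conjugate containing [s s^-1]; when [H] is
    infinitesimal this gives [s s^-1 <= t s^-1], hence [s <= t], and the action
    is faithful ([infinitesimal_noble]). *)

Set Implicit Arguments.
Unset Strict Implicit.
Unset Printing Implicit Defensive.

Local Open Scope classical_set_scope.
Local Open Scope group_scope.

Local Notation "s ^-1" := (invs s) : group_scope.

(** * Inverse semigroups and their natural order *)

Section Basics.
Variable S : inverseSemigroupType.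
Implicit Types (s t u v x y e f : S) (F H K : set S).

Lemma mulVK s : s * s^-1 * s = s.
Proof. by have [] := (invsP s s^-1).2 erefl. Qed.

Lemma mulKV s : s^-1 * s * s^-1 = s^-1.
Proof. by have [] := (invsP s s^-1).2 erefl. Qed.

Lemma invsK s : s^-1^-1 = s.
Proof. by symmetry; apply/invsP; split; [exact: mulKV|exact: mulVK]. Qed.

Lemma mulVKr x s : x * s * s^-1 * s = x * s.
Proof. by rewrite -2!mulgA [s * (_ * _)]mulgA mulVK. Qed.

Lemma mulKVr x s : x * s^-1 * s * s^-1 = x * s^-1.
Proof. by rewrite -{2}(invsK s) mulVKr. Qed.

Lemma invs_idem e : e * e = e -> e^-1 = e.
Proof. by move=> ee; symmetry; apply/invsP; split; rewrite !ee. Qed.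

Lemma idemVr s : s * s^-1 * (s * s^-1) = s * s^-1.
Proof. by rewrite mulgA mulVK. Qed.

Lemma idemVl s : s^-1 * s * (s^-1 * s) = s^-1 * s.
Proof. by rewrite mulgA mulKV. Qed.

(** With [x = (e f)^-1], the element [f x e] is also an inverse of [e f], so
    it equals [x]; but it is visibly idempotent, hence so is [e f = x^-1]. *)
Lemma idemM e f : e * e = e -> f * f = f -> e * f * (e * f) = e * f.
Proof.
move=> ee ff; set x := (e * f)^-1.
have xE : f * x * e = x.
  apply/invsP; split.
    have -> : e * f * (f * x * e) * (e * f) = e * (f * f) * x * (e * e) * f.
      by rewrite !mulgA.
    by rewrite ee ff -[RHS](mulVK (e * f)) /x !mulgA.
  have -> : f * x * e * (e * f) * (f * x * e)
            = f * (x * ((e * e) * (f * f)) * x) * e by rewrite !mulgA.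
  by rewrite ee ff mulKV.
have xx : x * x = x.
  rewrite -{1 2}xE.
  have -> : f * x * e * (f * x * e) = f * (x * (e * f) * x) * e.
    by rewrite !mulgA.
  by rewrite mulKV xE.
by rewrite -[e * f]invsK (invs_idem xx).
Qed.

(** Both [e f] and [f e] are inverses of the idempotent [e f]. *)
Lemma idemC e f : e * e = e -> f * f = f -> e * f = f * e.
Proof.
move=> ee ff; rewrite -(invs_idem (idemM ee ff)).
symmetry; apply/invsP; split.
  have -> : e * f * (f * e) * (e * f) = e * (f * f) * (e * e) * f.
    by rewrite !mulgA.
  by rewrite ff ee -mulgA idemM.
have -> : f * e * (e * f) * (f * e) = f * (e * e) * (f * f) * e.
  by rewrite !mulgA.
by rewrite ff ee -mulgA idemM.
Qed.

Lemma invsM s t : (s * t)^-1 = t^-1 * s^-1.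
Proof.
symmetry; apply/invsP; split.
  have -> : s * t * (t^-1 * s^-1) * (s * t)
            = s * (t * t^-1 * (s^-1 * s)) * t by rewrite !mulgA.
  by rewrite (idemC (idemVr t) (idemVl s)) !mulgA mulVK mulVKr.
have -> : t^-1 * s^-1 * (s * t) * (t^-1 * s^-1)
          = t^-1 * (s^-1 * s * (t * t^-1)) * s^-1 by rewrite !mulgA.
by rewrite (idemC (idemVl s) (idemVr t)) !mulgA mulKV mulKVr.
Qed.

Lemma idem_conj s e : e * e = e -> s * e * s^-1 * (s * e * s^-1) = s * e * s^-1.
Proof.
move=> ee.
have -> : s * e * s^-1 * (s * e * s^-1) = s * (e * (s^-1 * s)) * (e * s^-1).
  by rewrite !mulgA.
rewrite (idemC ee (idemVl s)) !mulgA mulVK -[s * e * e]mulgA.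
by rewrite ee.
Qed.

Lemma idem_le s e t : e * e = e -> s = e * t -> natural_le s t.
Proof.
move=> ee ->; rewrite /natural_le invsM (invs_idem ee).
have -> : e * t * (t^-1 * e) * t = e * (t * t^-1 * e) * t by rewrite !mulgA.
by rewrite (idemC (idemVr t) ee) !mulgA ee mulVKr.
Qed.

Lemma le_mull e y : e * e = e -> natural_le (e * y) y.
Proof. by move=> ee; exact: idem_le erefl. Qed.

(** Erasing an idempotent factor from a product enlarges it:
    [x e = (x e x^-1) x].  The monotonicity of products and all the membership
    arguments below reduce to this lemma. *)
Lemma le_erase x e y : e * e = e -> natural_le (x * e * y) (x * y).
Proof.
move=> ee; apply: (idem_le (idem_conj x ee)).
have -> : x * e * x^-1 * (x * y) = x * (e * (x^-1 * x)) * y by rewrite !mulgA.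
by rewrite (idemC ee (idemVl x)) !mulgA mulVK.
Qed.

Lemma le_mulr x e : e * e = e -> natural_le (x * e) x.
Proof.
move=> ee; apply: (idem_le (idem_conj x ee)).
by rewrite -!mulgA (idemC ee (idemVl x)) !mulgA mulVK.
Qed.

Lemma le_mul2r s t u : natural_le s t -> natural_le (s * u) (t * u).
Proof.
by rewrite {1}/natural_le => ->; rewrite -mulgA; exact/le_mull/idemVr.
Qed.

Lemma le_trans s t u : natural_le s t -> natural_le t u -> natural_le s u.
Proof.
rewrite {1 2}/natural_le => st tu.
by apply: idem_le (idemM (idemVr s) (idemVr t)) _; rewrite -mulgA -tu.
Qed.

Lemma le_antisym s t : natural_le s t -> natural_le t s -> s = t.
Proof.
rewrite /natural_le => st ts; rewrite [RHS]ts [X in _ = _ * X]st mulgA.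
by rewrite (idemC (idemVr t) (idemVr s)) -mulgA mulVK.
Qed.

Lemma subsingleton_one_element_group :
  (forall s t, s = t) -> one_element_group S.
Proof.
move=> eqS; have [s0] := @inhabitedS S; split.
  by exists s0; split=> [s|s]; [split|exists s; split]; exact: eqS.
have -> : [set: S] = [set s0] by apply/seteqP; split=> x //= _; exact: eqS.
exact: card_set1.
Qed.

Lemma same_magnitude_sym F1 F2 : same_magnitude F1 F2 -> same_magnitude F2 F1.
Proof. by case=> u [v [h12 h21]]; exists u^-1, v^-1; rewrite !invsK. Qed.

Lemma same_magnitude_trans F1 F2 F3 :
  same_magnitude F1 F2 -> same_magnitude F2 F3 -> same_magnitude F1 F3.
Proof.
case=> u [v [h12 h21]] [u' [v' [h23 h32]]].
exists (u' * u), (v' * v); rewrite !invsM; split=> _ [x Fx <-].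
  have -> : u' * u * x * (v^-1 * v'^-1) = u' * (u * x * v^-1) * v'^-1.
    by rewrite !mulgA.
  by apply: h23; exists (u * x * v^-1) => //; apply: h12; exists x.
have -> : u^-1 * u'^-1 * x * (v' * v) = u^-1 * (u'^-1 * x * v') * v.
  by rewrite !mulgA.
by apply: h21; exists (u'^-1 * x * v') => //; apply: h32; exists x.
Qed.

End Basics.

(** * The stabilizer of a filter *)

Section Stabilizer.
Variable S : inverseSemigroupType.
Implicit Types (s t u v x y e f g h k : S) (F : set S).

Definition stab F : set S := [set h | forall f, F f -> F (h * f)].

(** As for cosets of a group, moving one point of [F] inside [F] is enough:
    the triple [(h f) f^-1 g] lies below [h g]. *)
Lemma stabP F h f : is_filter F -> F f -> F (h * f) -> stab F h.
Proof.
move=> [_ _ Fup F3] Ff Fhf g Fg.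
apply: Fup (F3 _ _ _ Fhf Ff Fg) _.
rewrite /triple.
have -> : h * f * f^-1 * g = h * (f * f^-1) * g by rewrite !mulgA.
exact/le_erase/idemVr.
Qed.

Lemma stab_closed_inverse_subsemigroup F :
  is_filter F -> closed_inverse_subsemigroup (stab F).
Proof.
move=> FF; have [[f Ff] _ Fup F3] := FF.
split; first split.
- exists (f * f^-1); apply: (stabP FF Ff).
  by rewrite mulVK.
- by move=> s t Fs Ft g Fg; rewrite -mulgA; apply/Fs/Ft.
- move=> h Fh; apply: (stabP FF (Fh _ Ff)).
  (* [h^-1 h f] is the triple [f (h f)^-1 (h f)]. *)
  have := F3 _ _ _ Ff (Fh _ Ff) (Fh _ Ff); rewrite /triple invsM.
  have -> : f * (f^-1 * h^-1) * (h * f) = f * f^-1 * (h^-1 * h) * f.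
    by rewrite !mulgA.
  by rewrite (idemC (idemVr f) (idemVl h)) -2!mulgA mulVK mulgA.
- by move=> s t Fs st; apply: (stabP FF Ff); apply: Fup (Fs _ Ff) (le_mul2r _ st).
Qed.

Lemma inverse_subsemigroup_triple H : inverse_subsemigroup H ->
  forall s t u : S, H s -> H t -> H u -> H (triple s t u).
Proof.
by case=> _ HM HV s t u Hs Ht Hu; apply: (HM); [apply: HM => //; exact: HV|].
Qed.

(** If [stab F] is everything, then [F] contains the idempotent
    [e = f^-1 f], so also every [s e], hence every [s]. *)
Lemma stab_filter F : is_filter F -> is_filter (stab F).
Proof.
move=> FF; have [Hs Hup] := stab_closed_inverse_subsemigroup FF.
split=> //; [by case: Hs| |exact: inverse_subsemigroup_triple].
move=> HT; have [[f Ff] FT Fup _] := FF; apply: FT.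
have stabT s g : F g -> F (s * g).
  by have : stab F s by [rewrite HT]; exact.
apply/seteqP; split=> // s _.
exact: Fup (stabT s _ (stabT f^-1 _ Ff)) (le_mulr _ (idemVl f)).
Qed.

(** For [f] in [F] one has [F f^-1] in [stab F] and [(stab F) f] in [F]; the
    factor [f f^-1] stands for the missing identity element. *)
Lemma same_magnitude_stab F : is_filter F -> same_magnitude F (stab F).
Proof.
move=> FF; have [[f Ff] _ Fup F3] := FF.
exists (f * f^-1), f; split=> _ [x Fx <-].
  apply: (stabP FF Ff); rewrite -mulgA.
  have -> : f * f^-1 * x * (f^-1 * f) = triple (triple f f x) f f.
    by rewrite /triple !mulgA.
  by apply: (F3) => //; exact: F3.
rewrite invsM invsK.
have -> : f * f^-1 * x * f = triple f f (x * f) by rewrite /triple !mulgA.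
by apply: F3 => //; exact: Fx.
Qed.

(** With an idempotent [e] in [F], products and inverses are recovered from
    the triple product as [s e t] and [e s^-1 e]. *)
Lemma idem_filter_inverse_subsemigroup F e :
  is_filter F -> e * e = e -> F e -> inverse_subsemigroup F.
Proof.
move=> [F0 _ Fup F3] ee Fe; split=> // [s t Fs Ft|s Fs].
  have := F3 _ _ _ Fs Fe Ft; rewrite /triple (invs_idem ee) => /Fup.
  by apply; exact: le_erase.
apply: (Fup) (le_mull _ ee); apply: (Fup) (le_mulr _ ee).
exact: (F3 _ _ _ Fe Fs Fe).
Qed.

End Stabilizer.

(** * From transitive actions to infinitesimal bases *)

Section Action.
Variable S : inverseSemigroupType.
Implicit Types s t u v : S.

Lemma pinj_mulE (A : Type) (f g : partial_inj A) a c :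
  (f * g) a = Some c <-> exists2 b, f a = Some b & g b = Some c.
Proof. exact: pinj_compE. Qed.

Lemma pinj_invsE (A : Type) (f : partial_inj A) a b :
  (f^-1) b = Some a <-> f a = Some b.
Proof. exact: pinj_invE. Qed.

Lemma morph_invs (T : inverseSemigroupType) (h : S -> T) :
  {morph h : s t / s * t} -> {morph h : s / s^-1}.
Proof.
move=> hM s; apply/invsP; split; rewrite -!hM; [by rewrite mulVK|].
by rewrite mulKV.
Qed.

Lemma noble_infinitesimal_basis : ~ one_element_group S -> noble S ->
  exists (I : Type) (F : I -> set S), infinitesimal_basis F.
Proof.
move=> not_one [A [Phi [_ Phi_tr [h [_ h_inj h_surj] hM]]]].
have hV := morph_invs hM.
have injh s t : h s = h t -> s = t by apply: h_inj; rewrite inE.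
have tr a b : exists s, h s a = Some b.
  by have [f /h_surj[s _ <-] sab] := Phi_tr a b; exists s.
have hMP s t a b c : h s a = Some b -> h t b = Some c -> h (s * t) a = Some c.
  by move=> sa tb; rewrite hM; apply/pinj_mulE; exists b.
have hVP s a b : h s a = Some b -> h s^-1 b = Some a.
  by move=> sa; rewrite hV; apply/pinj_invsE.
(* [s <= t] means that [h s] is a restriction of [h t]. *)
have leP s t : natural_le s t <-> forall a b, h s a = Some b -> h t a = Some b.
  rewrite /natural_le; split=> [st a b sa|st].
    move: (sa); rewrite st hM => /pinj_mulE[c]; rewrite hM => /pinj_mulE[d sd].
    by rewrite hV => /pinj_invsE sc; rewrite (pinj_inj sd sc).
  apply: injh; apply: pinjP => a b; split=> [sa|].
    exact: hMP (hMP _ _ _ _ _ sa (hVP _ _ _ sa)) (st _ _ sa).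
  rewrite hM => /pinj_mulE[c]; rewrite hM => /pinj_mulE[d sd].
  rewrite hV => /pinj_invsE sc; rewrite -(pinj_inj sd sc) => tb.
  by rewrite sd -(st _ _ sd).
exists (A * A)%type, (fun ab => [set s | h s ab.1 = Some ab.2]); split.
- move=> [a b]; split=> /=.
  + exact: tr.
  + (* If all of [S] maps [a] to [b], transitivity forces [A] to be a point
       and every [h s] to be its identity map. *)
    move=> FT; have all_ab s : h s a = Some b.
      by have : [set: S] s by []; rewrite -FT.
    have Ab c : c = b by have [s] := tr a c; rewrite all_ab => -[].
    apply: not_one; apply: subsingleton_one_element_group => s t.
    apply: injh; apply: pinjP => c d.
    by rewrite (Ab c) (Ab d) -(Ab a) !all_ab (Ab a).
  + by move=> s t sa /leP; exact.
  + move=> s t u sa ta ua; rewrite /triple.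
    exact: hMP (hMP _ _ _ _ _ sa (hVP _ _ _ ta)) ua.
- move=> [a b] [c d]; have [u uca] := tr c a; have [v vdb] := tr d b.
  exists u, v; split=> _ [s /= sP <-].
    exact: hMP (hMP _ _ _ _ _ uca sP) (hVP _ _ _ vdb).
  exact: hMP (hMP _ _ _ _ _ (hVP _ _ _ uca) sP) vdb.
- move=> s; apply/seteqP; split=> [t /leP st [a b] /= sa|t st]; first exact: st.
  by apply/leP => a b sa; exact: (st (a, b)).
Qed.

End Action.

(** * From infinitesimal bases to infinitesimal subsemigroups *)

Lemma basis_infinitesimal (S : inverseSemigroupType) (I : Type) (F : I -> set S) :
  infinitesimal_basis F ->
  exists H : set S, closed_inverse_subsemigroup H /\ infinitesimal H.
Proof.
move=> [FF Fm Fup].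
have [[i0]|noI] := pselect (inhabited I); last first.
  (* With an empty basis, every nonempty closed subset is all of [S], so there
     is no filter, and [H = S] works with an empty set of conjugates. *)
  have upT s : up s = [set: S].
    by rewrite Fup; apply/seteqP; split=> // t _ i; case: noI.
  exists [set: S]; split.
    by split=> //; split=> //; have [s] := @inhabitedS S; exists s.
  move=> e _; rewrite upT; apply/esym/seteqP; split=> // t _ K.
  move=> [[[_ Kup] _] Ke].
  by apply: Kup Ke _; have : [set: S] t by []; rewrite -(upT e).
have HF := stab_filter (FF i0).
have Hc := stab_closed_inverse_subsemigroup (FF i0).
exists (stab (F i0)); split=> // e ee; apply/seteqP; split.
  by move=> t et K [[[_ Kup] _] Ke]; exact: Kup Ke et.
move=> t Kt; rewrite Fup => i /= Fie; apply: (Kt (F i)); split=> //.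
have Fi := idem_filter_inverse_subsemigroup (FF i) ee Fie.
have [_ _ Fi_up _] := FF i.
split; split=> //; first by case: Hc.
exact: same_magnitude_trans (same_magnitude_sym (same_magnitude_stab (FF i0)))
  (Fm i0 i).
Qed.

(** * The action on the cosets of a closed inverse subsemigroup *)

Section CosetAction.
Variable S : inverseSemigroupType.
Implicit Types (s t u v g h k p q r : S) (H K P Q : set S).

(** The two parameters [u], [v] of a magnitude relation between inverse
    subsemigroups can be taken equal: with [f = h^-1 h], the element
    [(u h v^-1) (u f v^-1)^-1 = u h (v^-1 v) f u^-1] of [K] lies below
    [u h u^-1]. *)
Lemma same_magnitude_conj H K u v :
  inverse_subsemigroup H -> closed_inverse_subsemigroup K ->
  [set u * f * v^-1 | f in H] `<=` K -> forall h, H h -> K (u * h * u^-1).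
Proof.
move=> [_ HM HV] [[_ KM KV] Kup] HK h Hh.
have uvK g : H g -> K (u * g * v^-1) by move=> Hg; apply: HK; exists g.
have Hf : H (h^-1 * h) by apply: HM => //; exact: HV.
have := KM _ _ (uvK _ Hh) (KV _ (uvK _ Hf)).
rewrite !invsM !invsK.
have -> : u * h * v^-1 * (v * (h^-1 * h * u^-1))
          = u * h * (v^-1 * v) * (h^-1 * h * u^-1) by rewrite !mulgA.
move=> /Kup/(_ (le_erase _ _ (idemVl v))).
by rewrite !mulgA mulVKr.
Qed.

Lemma conjugate_conj H K : closed_inverse_subsemigroup H -> conjugates H K ->
  exists u, forall k, K k <-> H (u^-1 * k * u).
Proof.
move=> Hc [Kc [Hs Ks _ _ [u [v [HK KH]]]]].
have HuK := same_magnitude_conj Hs Kc HK.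
have KuH : forall k, K k -> H (u^-1 * k * u).
  move=> k Kk; rewrite -{2}(invsK u);
  apply: same_magnitude_conj (v^-1) Ks Hc _ _ Kk.
  by rewrite invsK; exact: KH.
exists u => k; split=> [|/HuK]; first exact: KuH.
have -> : u * (u^-1 * k * u) * u^-1 = u * u^-1 * k * (u * u^-1).
  by rewrite !mulgA.
have [_ Kup] := Kc.
move=> /Kup/(_ (le_mulr _ (idemVr u)))/Kup; apply.
exact/le_mull/idemVr.
Qed.

(** Right cosets as subsets, so that no quotient type is needed.  Only the [s]
    with [s s^-1] in [H] lie in a coset. *)
Definition coset H P : Prop :=
  P !=set0 /\ forall s t, P s -> (P t <-> H (t * s^-1)).

Definition coset_of H s : set S := [set t | H (t * s^-1)].

Section Cosets.
Variables (H : set S) (Hc : closed_inverse_subsemigroup H).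

Let HM s t : H s -> H t -> H (s * t). Proof. by have [[_ + _] _] := Hc; apply. Qed.
Let HV s : H s -> H s^-1. Proof. by have [[_ _ +] _] := Hc; apply. Qed.
Let Hup s t : H s -> natural_le s t -> H t. Proof. by have [_] := Hc; apply. Qed.

Lemma quotient_sym s t : H (s * t^-1) -> H (t * s^-1).
Proof. by move=> /HV; rewrite invsM invsK. Qed.

Lemma quotient_trans s t r : H (s * t^-1) -> H (t * r^-1) -> H (s * r^-1).
Proof.
move=> st tr; apply: Hup (HM st tr) _.
have -> : s * t^-1 * (t * r^-1) = s * (t^-1 * t) * r^-1 by rewrite !mulgA.
exact/le_erase/idemVl.
Qed.

Lemma coset_of_coset s : H (s * s^-1) -> coset H (coset_of H s).
Proof.
move=> Hs; split=> [|t r /= ts]; first by exists s.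
split=> [rs|rt]; last exact: quotient_trans rt ts.
by apply: quotient_trans rs _; exact: quotient_sym.
Qed.

Lemma coset_eq P Q s : coset H P -> coset H Q -> P s -> Q s -> P = Q.
Proof.
move=> [_ cP] [_ cQ] Ps Qs; apply/seteqP.
by split=> t; rewrite /= (cP s) // (cQ s).
Qed.

(** The action is independent of the representative, because
    [(q p^-1) (p g (p g)^-1) = q g (p g)^-1]. *)
Lemma coset_act P Q p q g : coset H P -> coset H Q ->
  P p -> P q -> Q (p * g) -> Q (q * g).
Proof.
move=> [_ cP] [_ cQ] Pp Pq Qpg; apply/(cQ _ _ Qpg).
have := HM ((cP _ _ Pp).1 Pq) ((cQ _ _ Qpg).1 Qpg).
rewrite !invsM.
have -> : q * p^-1 * (p * g * (g^-1 * p^-1))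
          = q * (p^-1 * p * (g * g^-1)) * p^-1 by rewrite !mulgA.
by rewrite (idemC (idemVl p) (idemVr g)) !mulgA mulKVr.
Qed.

Lemma coset_act_inj P P' Q p q g : coset H P -> coset H P' -> coset H Q ->
  P p -> P' q -> Q (p * g) -> Q (q * g) -> P = P'.
Proof.
move=> cP cP' cQ Pp Pq Qp Qq; apply: (coset_eq cP cP' _ Pq).
apply/(cP.2 _ _ Pp); have := (cQ.2 _ _ Qp).1 Qq; rewrite invsM.
have -> : q * g * (g^-1 * p^-1) = q * (g * g^-1) * p^-1 by rewrite !mulgA.
by move/Hup; apply; exact/le_erase/idemVr.
Qed.

Definition cosets := {P : set S | coset H P}.

Definition coset_rel g (P Q : cosets) : Prop :=
  exists2 p, sval P p & sval Q (p * g).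

Definition coset_fun g (P : cosets) : option cosets :=
  if pselect (exists Q : cosets, coset_rel g P Q) is left ex
  then Some (projT1 (cid ex))
  else None.

Lemma cosets_eq (P Q : cosets) s : sval P s -> sval Q s -> P = Q.
Proof.
case: P Q => [P cP] [Q cQ] /= Ps Qs; apply: eq_exist => /=.
exact: coset_eq Qs.
Qed.

Lemma coset_funE g (P Q : cosets) : coset_fun g P = Some Q <-> coset_rel g P Q.
Proof.
rewrite /coset_fun; case: pselect => [ex|nex]; last first.
  by split=> // PQ; case: nex; exists Q.
case: cid => Q' /= PQ'; split=> [[<-]//|[p Pp Qp]]; congr Some.
case: PQ' => q Pq Qq; apply: cosets_eq Qp.
exact: coset_act (svalP P) (svalP Q') Pq Pp Qq.
Qed.

Lemma coset_fun_inj g (P P' Q : cosets) :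
  coset_fun g P = Some Q -> coset_fun g P' = Some Q -> P = P'.
Proof.
move=> /coset_funE[p Pp Qp] /coset_funE[q Pq Qq].
apply: (cosets_eq Pp).
by rewrite -(coset_act_inj (svalP P) (svalP P') (svalP Q) Pp Pq Qp Qq).
Qed.

Definition coset_pinj g : partial_inj cosets := PartialInj (@coset_fun_inj g).

Lemma coset_pinjE g (P Q : cosets) : coset_pinj g P = Some Q <-> coset_rel g P Q.
Proof. exact: coset_funE. Qed.

Lemma coset_pinjM : {morph coset_pinj : s t / s * t}.
Proof.
move=> s t; apply: pinjP => P R; split.
  move=> /coset_pinjE[p Pp Rp]; apply/pinj_mulE.
  have Hps : H (p * s * (p * s)^-1).
    have := ((svalP R).2 _ _ Rp).1 Rp; rewrite !invsM.
    have -> : p * (s * t) * (t^-1 * s^-1 * p^-1)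
              = p * s * (t * t^-1) * (s^-1 * p^-1) by rewrite !mulgA.
    by move/Hup; apply; exact/le_erase/idemVr.
  exists (exist _ _ (coset_of_coset Hps)); apply/coset_pinjE; first by exists p.
  by exists (p * s) => //=; rewrite -mulgA.
move=> /pinj_mulE[Q /coset_pinjE[p Pp Qp] /coset_pinjE[q Qq Rq]].
apply/coset_pinjE; exists p => //; rewrite mulgA.
exact: coset_act (svalP Q) (svalP R) Qq Qp Rq.
Qed.

Lemma coset_pinj_transitive : transitive_set (range coset_pinj).
Proof.
move=> P Q; have [p Pp] := (svalP P).1; have [q Qq] := (svalP Q).1.
exists (coset_pinj (p^-1 * q)); first by exists (p^-1 * q).
apply/coset_pinjE; exists p => //; apply/((svalP Q).2 _ _ Qq).
have := HM (((svalP P).2 _ _ Pp).1 Pp) (((svalP Q).2 _ _ Qq).1 Qq).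
by rewrite !mulgA.
Qed.

Hypothesis Hinf : infinitesimal H.

(** The coset of [u^-1] has stabilizer [K = {k | u^-1 k u in H}].  If [K]
    contains [s s^-1], then [s] sends it to the coset of [u^-1 s]; as [t] does
    the same, [t s^-1] stabilizes it.  Hence [s s^-1 <= t s^-1]. *)
Lemma coset_pinj_le s t : coset_pinj s = coset_pinj t -> natural_le s t.
Proof.
move=> st; suff : natural_le (s * s^-1) (t * s^-1).
  move/(le_mul2r s); rewrite mulVK -mulgA => /le_trans; apply.
  exact/le_mulr/idemVl.
have : up (s * s^-1) (t * s^-1); last by [].
rewrite (Hinf (idemVr s)) => K [KH Ke].
have [u uP] := conjugate_conj Hc KH.
have Hus : H (u^-1 * s * (u^-1 * s)^-1).
  by rewrite invsM invsK -[_ * (s^-1 * u)]mulgA [s * _]mulgA mulgA; apply/uP.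
have Hu : H (u^-1 * u^-1^-1).
  move: Hus; rewrite invsM.
  have -> : u^-1 * s * (s^-1 * u^-1^-1) = u^-1 * (s * s^-1) * u^-1^-1.
    by rewrite !mulgA.
  by move/Hup; apply; exact/le_erase/idemVr.
pose P : cosets := exist _ _ (coset_of_coset Hu).
pose Q : cosets := exist _ _ (coset_of_coset Hus).
have /coset_pinjE : coset_rel s P Q by exists u^-1.
rewrite st => /coset_pinjE[p Pp Qp].
have := coset_act (svalP P) (svalP Q) Pp Hu Qp.
by rewrite /= /coset_of /= invsM invsK => Ht; apply/uP; rewrite !mulgA in Ht *.
Qed.

End Cosets.

Lemma infinitesimal_noble H :
  closed_inverse_subsemigroup H -> infinitesimal H -> noble S.
Proof.
move=> Hc Hinf; pose h := coset_pinj Hc.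
have hM : {morph h : s t / s * t} by exact: coset_pinjM.
exists (cosets H), (range h); split.
- split.
  + by have [s] := @inhabitedS S; exists (h s); exists s.
  + by move=> _ _ [s _ <-] [t _ <-]; exists (s * t).
  + by move=> _ [s _ <-]; exists s^-1 => //; exact: morph_invs.
- exact: coset_pinj_transitive.
- exists h => //; split=> [s _|s t _ _ hst|f//]; first by exists s.
  exact: le_antisym (coset_pinj_le Hinf hst) (coset_pinj_le Hinf (esym hst)).
Qed.

End CosetAction.

Theorem mainTheorem1 (S : inverseSemigroupType)
    (not_one : ~ one_element_group S) (not_two : ~ two_element_semilattice S) :
  (noble S <-> exists (I : Type) (F : I -> set S), infinitesimal_basis F) /\
  ((exists (I : Type) (F : I -> set S), infinitesimal_basis F) <->
   (exists H : set S, closed_inverse_subsemigroup H /\ infinitesimal H)).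
Proof.
have basis_of_noble := noble_infinitesimal_basis not_one.
have sub_of_basis : (exists (I : Type) (F : I -> set S), infinitesimal_basis F) ->
    exists H : set S, closed_inverse_subsemigroup H /\ infinitesimal H.
  by move=> [I [F]]; exact: basis_infinitesimal.
have noble_of_sub : (exists H : set S,
    closed_inverse_subsemigroup H /\ infinitesimal H) -> noble S.
  by move=> [H [Hc Hi]]; exact: infinitesimal_noble Hc Hi.
by split; split; auto.
Qed.
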